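(* Let $\Gamma$ be a non-elementary hyperbolic group, let $\partial\Gamma$ be its Gromov boundary and let $\overline{\Gamma}=\Gamma\cup\partial\Gamma$ be the Gromov compactification of $\Gamma$. Then there exists no $\Gamma$-equivariant retraction $\overline{\Gamma}\to\partial\Gamma$.
   Context: Hyperbolic means finitely generated and Gromov hyperbolic as a discrete group; $\Gamma$ acts on $\overline{\Gamma}$ by the continuous extension of left multiplication. A retraction $\overline{\Gamma}\to\partial\Gamma$ is a continuous map $\varphi$ with $\varphi(x)=x$ for all $x\in\partial\Gamma$; it is $\Gamma$-equivariant if $\varphi(gz)=g\varphi(z)$ for all $g\in\Gamma$, $z\in\overline{\Gamma}$. *)

(* Defs.v *)
From HB Require Import structures.
From mathcomp Require Import all_boot all_order all_algebra.
From mathcomp Require Import all_classical all_reals all_analysis.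
From mathcomp Require Import lra.

Set Implicit Arguments.
Unset Strict Implicit.
Unset Printing Implicit Defensive.

Import Order.TTheory GRing.Theory Num.Theory numFieldNormedType.Exports.

Local Open Scope classical_set_scope.
Local Open Scope ring_scope.

Definition is_word (G : groupType) (S w : seq G) : bool :=
  all (fun s => (s \in S) || (s^-1%g \in S)) w.

Definition generates (G : groupType) (S : seq G) : Prop :=
  forall g : G, exists2 w, is_word S w & (\prod_(s <- w) s)%g = g.

Record finGenSet (G : groupType) := FinGenSet {
  gens :> seq G;
  gens_generate : generates gens
}.

Definition virtually_cyclic (G : groupType) : Prop :=
  exists (z : G) (T : seq G), forall g : G,
    exists t n, t \in T /\ (g = (t * z ^+ n)%g \/ g = (t * z ^- n)%g).

(* A hyperbolic group is elementary when its boundary has at most two points,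
   equivalently when it is finite or virtually infinite cyclic; both cases are
   covered by [virtually_cyclic] (the cyclic subgroup may be finite). *)
Definition non_elementary (G : groupType) : Prop := ~ virtually_cyclic G.

Section WordMetric.
Context (G : groupType) (S : finGenSet G).

Definition has_word_of_size (g : G) (n : nat) : bool :=
  `[< exists w, [/\ is_word S w, size w = n & (\prod_(s <- w) s)%g = g] >].

Lemma has_word (g : G) : exists n, has_word_of_size g n.
Proof.
have [w Sw wg] := gens_generate S g.
by exists (size w); apply/asboolP; exists w.
Qed.

Definition word_norm (g : G) : nat := ex_minn (has_word g).

Definition word_dist (x y : G) : nat := word_norm (x^-1 * y)%g.

Lemma word_normM (x y : G) :
  (word_norm (x * y)%g <= word_norm x + word_norm y)%N.
Proof.
rewrite /word_norm.
case: (ex_minnP (has_word x)) => m /asboolP[u [Su <- <-]] _.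
case: (ex_minnP (has_word y)) => n /asboolP[v [Sv <- <-]] _.
case: ex_minnP => k _; apply; apply/asboolP; exists (u ++ v).
by rewrite /is_word all_cat size_cat big_cat; split => //; apply/andP.
Qed.

Lemma word_distM (g x y : G) : word_dist (g * x)%g (g * y)%g = word_dist x y.
Proof. by rewrite /word_dist invgM -mulgA (mulgA g^-1%g) mulVg mul1g. Qed.

Lemma word_dist_triangle (x y z : G) :
  (word_dist x z <= word_dist x y + word_dist y z)%N.
Proof.
have := word_normM (x^-1 * y)%g (y^-1 * z)%g.
by rewrite -mulgA (mulgA y) mulgV mul1g.
Qed.

End WordMetric.

Section Gromov.
Context (R : realType) (G : groupType) (S : finGenSet G).

Definition gromov_product (w x y : G) : R :=
  ((word_dist S w x)%:R + (word_dist S w y)%:R - (word_dist S x y)%:R) / 2.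

(* Gromov's four-point condition for the word metric; whether it holds does not
   depend on the finite generating set, and neither does the compactification
   below, up to a canonical equivariant homeomorphism. *)
Definition gromov_hyperbolic : Prop :=
  exists delta : R, forall w x y z : G,
    Num.min (gromov_product w x y) (gromov_product w y z) - delta
      <= gromov_product w x z.

(* (u_i | v_j)_1 --> +oo as i, j --> +oo *)
Definition equiv_at_infinity (u v : nat -> G) : Prop :=
  (fun p : nat * nat => gromov_product 1%g (u p.1) (v p.2))
    @ filter_prod \oo \oo --> +oo.

Definition converges_at_infinity (u : nat -> G) : Prop := equiv_at_infinity u u.

Definition boundary_class (u : nat -> G) : set (nat -> G) :=
  [set v | converges_at_infinity v /\ equiv_at_infinity u v].

(* Points at infinity are the equivalence classes themselves; that
   [equiv_at_infinity] is transitive on sequences converging at infinity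
   follows from [gromov_hyperbolic]. *)
Definition gromov_boundary : Type :=
  {xi : set (nat -> G) |
    exists2 u, converges_at_infinity u & xi = boundary_class u}.

Variant gromov_compactification : Type :=
  | InGroup of G
  | AtInfinity of gromov_boundary.

HB.instance Definition _ := gen_eqMixin gromov_boundary.
HB.instance Definition _ := gen_choiceMixin gromov_boundary.
HB.instance Definition _ := gen_eqMixin gromov_compactification.
HB.instance Definition _ := gen_choiceMixin gromov_compactification.

Definition represents (z : gromov_compactification) (u : nat -> G) : Prop :=
  match z with
  | InGroup g => \forall n \near \oo, u n = g
  | AtInfinity xi => sval xi u
  end.

(* (x | y) = sup liminf_(i, j) (u_i | v_j)_1, over all u --> x and v --> y *)
Definition extended_gromov_product (x y : gromov_compactification) : \bar R :=
  ereal_sup [set l | exists u v, [/\ represents x u, represents y v &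
    l = limf_einf (fun p : nat * nat => (gromov_product 1%g (u p.1) (v p.2))%:E)
                  (filter_prod \oo \oo)]].

(* The points of G are isolated, and a point xi at infinity has the sets
   [{z | (xi | z) > k}] as a neighbourhood basis. *)
Definition compactification_open (U : set gromov_compactification) : Prop :=
  forall xi : gromov_boundary, U (AtInfinity xi) ->
    exists k : R, forall z, (k%:E < extended_gromov_product (AtInfinity xi) z)%E ->
      U z.

Lemma compactification_openT : compactification_open setT.
Proof. by move=> xi _; exists 0. Qed.

Lemma compactification_openI : setI_closed compactification_open.
Proof.
move=> U V oU oV xi [/oU[k kU] /oV[l lV]]; exists (Num.max k l) => z.
by rewrite EFin_max gt_max => /andP[/kU Uz /lV Vz].
Qed.

Lemma compactification_open_bigU (I : Type)
    (U : I -> set gromov_compactification) :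
  (forall i, compactification_open (U i)) ->
  compactification_open (\bigcup_i U i).
Proof.
move=> oU xi [i _ /oU[k kU]]; exists k => z /kU Uz.
by exists i.
Qed.

HB.instance Definition _ := isOpenTopological.Build gromov_compactification
  compactification_openT compactification_openI compactification_open_bigU.

HB.instance Definition _ := Topological.copy gromov_boundary
  (initial_topology AtInfinity).

Lemma gromov_product_translate (g x y : G) :
  gromov_product 1%g x y - (word_dist S g 1%g)%:R <=
    gromov_product 1%g (g * x)%g (g * y)%g.
Proof.
have le z : ((word_dist S 1%g z)%:R : R) <=
    (word_dist S g 1%g)%:R + (word_dist S 1%g (g * z)%g)%:R.
  rewrite -natrD ler_nat -(word_distM S g 1%g z) mulg1.
  exact: word_dist_triangle.
have := le x; have := le y; rewrite /gromov_product word_distM; lra.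
Qed.

Lemma equiv_at_infinity_translate (g : G) (u v : nat -> G) :
  equiv_at_infinity u v ->
  equiv_at_infinity (fun n => g * u n)%g (fun n => g * v n)%g.
Proof.
rewrite /equiv_at_infinity => /cvgryPge uv; apply/cvgryPge => A.
apply: filterS (uv (A + (word_dist S g 1%g)%:R)) => p Ap.
by apply: le_trans (gromov_product_translate _ _ _); rewrite lerBrDr.
Qed.

Lemma boundary_class_translate (g : G) (u : nat -> G) :
  [set (fun n => g * v n)%g | v in boundary_class u] =
  boundary_class (fun n => g * u n)%g.
Proof.
have gK (h : G) (w : nat -> G) : (fun n => h^-1 * (h * w n))%g = w.
  by apply/funext => n; rewrite mulKg.
apply/seteqP; split=> [_ [v [cv uv] <-]|w [cw uw]].
  by split; apply: equiv_at_infinity_translate.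
exists (fun n => g^-1 * w n)%g; last by apply/funext => n; rewrite mulVKg.
split; first exact: equiv_at_infinity_translate.
by rewrite -(gK g u); apply: equiv_at_infinity_translate.
Qed.

Lemma boundary_act_subproof (g : G) (xi : gromov_boundary) :
  exists2 u, converges_at_infinity u &
    [set (fun n => g * v n)%g | v in sval xi] = boundary_class u.
Proof.
have [u cu ->] := svalP xi; exists (fun n => g * u n)%g.
  exact: equiv_at_infinity_translate.
exact: boundary_class_translate.
Qed.

(* g [u] = [g u], the continuous extension of left multiplication. *)
Definition boundary_act (g : G) (xi : gromov_boundary) : gromov_boundary :=
  exist _ _ (boundary_act_subproof g xi).

Definition compactification_act (g : G) (z : gromov_compactification) :
    gromov_compactification :=
  match z with
  | InGroup h => InGroup (g * h)%g
  | AtInfinity xi => AtInfinity (boundary_act g xi)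
  end.

Definition retraction (phi : gromov_compactification -> gromov_boundary) : Prop :=
  continuous phi /\ forall xi, phi (AtInfinity xi) = xi.

Definition equivariant (phi : gromov_compactification -> gromov_boundary) : Prop :=
  forall g z, phi (compactification_act g z) = boundary_act g (phi z).

End Gromov.

Arguments gromov_boundary : clear implicits.
Arguments gromov_boundary R {G} S.
Arguments gromov_compactification : clear implicits.
Arguments gromov_compactification R {G} S.
Arguments gromov_hyperbolic : clear implicits.
Arguments gromov_hyperbolic R {G} S.

(* Main.v *)
Require Import Defs.
From mathcomp Require Import all_boot all_order all_algebra.
From mathcomp Require Import all_classical all_reals all_analysis.
From mathcomp Require Import lra zify.

Set Implicit Arguments.
Unset Strict Implicit.
Unset Printing Implicit Defensive.

Import Order.TTheory GRing.Theory Num.Theory numFieldNormedType.Exports.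

Local Open Scope classical_set_scope.
Local Open Scope ring_scope.

(** An equivariant retraction phi is determined by the point xi0 = phi(1), since
    phi(g) = g xi0; continuity at infinity says that g_n xi0 tends to xi
    whenever g_n tends to a boundary point xi. This fails for the inverses of
    points marching towards xi0.

    Let u_m be a sequence of group elements representing xi0, and let x_n be the
    point at distance n from 1 on a geodesic from 1 to a far u_m. By
    hyperbolicity all later geodesics [1, u_m] pass near x_n, that is,
    (1 | u_m)_{x_n} <= delta for m large ([ray_point]). Translating by x_n^-1
    gives (x_n^-1 | x_n^-1 u_m)_1 <= delta: seen from 1, the elements
    g_n = x_n^-1 and the points g_n xi0 lie in different directions. As
    |g_n| = n and balls are finite, König's lemma ([konig]) extracts a
    subsequence of the g_n whose geodesic words share longer and longer
    prefixes, so that it converges to a boundary point Xi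
    ([converging_subsequence]). Continuity of phi at Xi makes (Xi | g_n xi0)
    large for n large; (Xi | g_n) is large too, hence so is
    (g_n | g_n xi0)_1, a contradiction.

    To exploit continuity one needs the sets {z | (xi | z) > K} to be
    neighbourhoods of xi ([nbhs_shadow]), although they need not be open; this
    rests on hyperbolicity, which makes the extended Gromov product satisfy
    the ultrametric inequality up to a constant ([shadow_trans]). *)

(** * König's lemma *)

(** Call a word recurrent when it is a prefix of infinitely many [s n]. Over a
    finite alphabet every recurrent word has a recurrent one-letter extension,
    and iterating from the empty word gives an infinite branch. *)
Lemma konig (T : eqType) (A : seq T) (s : nat -> seq T) :
  (forall n, {subset s n <= A}) -> (forall n, (n <= size (s n))%N) ->
  exists (w : nat -> seq T) (f : nat -> nat),
    [/\ forall k, size (w k) = k,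
        forall i j, (i <= j)%N -> prefix (w i) (w j) &
        forall k, prefix (w k) (s (f k))].
Proof.
move=> sA s_large.
pose recurrent w := forall N, exists2 n, (N <= n)%N & prefix w (s n).
have extend w : exists a, recurrent w -> recurrent (rcons w a).
  have a0 : T by have := s_large 1; case: (s 1) => [|a].
  have [rw|nrw] := pselect (recurrent w); last by exists a0.
  (* Otherwise each letter a stops extending w after some N a; an index beyond
     all of these leaves no letter to follow w. *)
  apply: contrapT => /forallNP none.
  have bound a : exists N, forall n, (N <= n)%N -> ~~ prefix (rcons w a) (s n).
    apply: contrapT => /forallNP nb; apply: (none a) => _ N.
    have /existsNP[n /not_implyP[Nn /negP]] := nb N.
    by rewrite negbK; exists n.
  have [N N_bound] := choice bound.
  have [n n_large /prefixP[t wt]] := rw (maxn (size w).+1 (\max_(a <- A) N a)).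
  have := s_large n; rewrite wt; move: wt; case: t => [|a t] wt.
    by rewrite cats0; lia.
  have aA : a \in A by apply: (sA n); rewrite wt mem_cat inE eqxx orbT.
  have Na : (N a <= n)%N.
    apply: leq_trans n_large; apply: leq_trans (leq_maxr _ _).
    exact: leq_bigmax_seq.
  by have := N_bound a n Na; rewrite wt -cat_rcons prefix_prefix.
have [next nextP] := choice extend.
pose w k := iter k (fun v => rcons v (next v)) [::].
have rec_w k : recurrent (w k).
  by elim: k => [N|k IH]; [exists N => //; rewrite prefix0s | exact: nextP].
have w_in_s k : exists n, prefix (w k) (s n).
  by have [n _ wn] := rec_w k 0; exists n.
have [f fP] := choice w_in_s.
exists w, f; split=> //.
  by elim=> [//|k IH]; rewrite /= size_rcons -/(w k) IH.
move=> i j /subnK <-; elim: (j - i)%N => [|d IH]; first exact: prefix_refl.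
exact: prefix_trans IH (prefix_rcons _ _).
Qed.

(** * Word norm and geodesic words *)

Section Words.
Context (G : groupType) (S : finGenSet G).
Implicit Types (g h x y : G) (w : seq G).

Lemma is_word_cat u v : is_word S (u ++ v) = is_word S u && is_word S v.
Proof. exact: all_cat. Qed.

Lemma is_word_inv w : is_word S w -> is_word S (rev [seq s^-1%g | s <- w]).
Proof.
rewrite /is_word all_rev all_map; apply: sub_all => s /=.
by rewrite invgK orbC.
Qed.

Lemma word_letters w :
  is_word S w -> {subset w <= S ++ [seq s^-1%g | s <- S]}.
Proof.
move=> /allP Sw s /Sw /orP[sS|sS]; rewrite mem_cat ?sS //.
by apply/orP; right; apply/mapP; exists s^-1%g; rewrite ?invgK.
Qed.

Lemma geodesic_word g : exists w,
  [/\ is_word S w, size w = word_norm S g & (\prod_(s <- w) s)%g = g].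
Proof. by rewrite /word_norm; case: ex_minnP => n /asboolP. Qed.

Lemma word_norm_prod w :
  is_word S w -> (word_norm S (\prod_(s <- w) s)%g <= size w)%N.
Proof.
by move=> Sw; rewrite /word_norm; case: ex_minnP => n _; apply; apply/asboolP;
  exists w.
Qed.

Lemma word_norm1 : word_norm S 1%g = 0.
Proof. by have := @word_norm_prod [::] isT; rewrite big_nil leqn0 => /eqP. Qed.

Lemma word_normV g : word_norm S g^-1%g = word_norm S g.
Proof.
have le h : (word_norm S h^-1%g <= word_norm S h)%N.
  have [w [Sw <- <-]] := geodesic_word h.
  have := word_norm_prod (is_word_inv Sw).
  by rewrite size_rev size_map -map_rev big_map prodgV revK.
by apply/eqP; rewrite eqn_leq le /= -{1}(invgK g) le.
Qed.

(** A shorter word for either factor would shorten the whole word. *)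
Lemma geodesic_cat u v :
  is_word S (u ++ v) ->
  word_norm S (\prod_(s <- u ++ v) s)%g = size (u ++ v) ->
  word_norm S (\prod_(s <- u) s)%g = size u /\
  word_norm S (\prod_(s <- v) s)%g = size v.
Proof.
rewrite is_word_cat big_cat size_cat => /andP[Su Sv] /=.
have := word_normM S (\prod_(s <- u) s)%g (\prod_(s <- v) s)%g.
move: (word_norm_prod Su) (word_norm_prod Sv).
move: (word_norm S (_ * _)%g) (word_norm S _) (word_norm S _) => n p q.
lia.
Qed.

Lemma word_distC x y : word_dist S x y = word_dist S y x.
Proof. by rewrite /word_dist -word_normV invgM invgK. Qed.

Lemma word_dist1g x : word_dist S 1%g x = word_norm S x.
Proof. by rewrite /word_dist invg1 mul1g. Qed.

Lemma word_dist_xx x : word_dist S x x = 0.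
Proof. by rewrite /word_dist mulVg word_norm1. Qed.

End Words.

(** * Gromov products at a base point *)

Section GromovProduct.
Context (R : realType) (G : groupType) (S : finGenSet G).
Implicit Types (g w x y z : G).

Local Notation gp := (@gromov_product R G S).
Local Notation dist x y := ((word_dist S x y)%:R : R).

Lemma distR_triangle y x z : dist x z <= dist x y + dist y z.
Proof. by rewrite -natrD ler_nat word_dist_triangle. Qed.

Lemma gromov_productC w x y : gp w x y = gp w y x.
Proof. by rewrite /gromov_product (word_distC S x) (addrC (dist w x)). Qed.

Lemma gromov_productM g w x y : gp (g * w)%g (g * x)%g (g * y)%g = gp w x y.
Proof. by rewrite /gromov_product !word_distM. Qed.

Lemma gromov_product_xx w x : gp w x x = dist w x.
Proof. by rewrite /gromov_product word_dist_xx; lra. Qed.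

Lemma gromov_product_base w' w x y : gp w x y - dist w w' <= gp w' x y.
Proof.
have := distR_triangle w' w x; have := distR_triangle w' w y.
rewrite /gromov_product; lra.
Qed.

(** The two geodesics run together along [w], so the remaining distance is at
    most the sum of the lengths of the two tails. *)
Lemma gromov_product_prefix (w u v : seq G) :
  is_word S u -> is_word S v ->
  word_norm S (\prod_(s <- u) s)%g = size u ->
  word_norm S (\prod_(s <- v) s)%g = size v ->
  prefix w u -> prefix w v ->
  (size w)%:R <= gp 1%g (\prod_(s <- u) s)%g (\prod_(s <- v) s)%g.
Proof.
move=> Su Sv gu gv /prefixP[a ua] /prefixP[b vb]; subst u v.
have [_ ga] := geodesic_cat Su gu; have [_ gb] := geodesic_cat Sv gv.
rewrite /gromov_product !word_dist1g gu gv !big_cat word_distM /=.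
have := distR_triangle 1%g (\prod_(s <- a) s)%g (\prod_(s <- b) s)%g.
rewrite (word_distC S _ 1%g) !word_dist1g ga gb !size_cat !natrD; lra.
Qed.

(** [gp x 1 g = 0] says that [x] lies on a geodesic from [1] to [g]; the point
    is given by the first [n] letters of a geodesic word for [g]. *)
Lemma geodesic_point g (n : nat) : (n <= word_norm S g)%N ->
  exists2 x, word_norm S x = n & gp x 1%g g = 0.
Proof.
have [w [Sw sw wg]] := geodesic_word S g; subst g; rewrite -sw => nw.
have [gx gy] : word_norm S (\prod_(s <- take n w) s)%g = size (take n w) /\
               word_norm S (\prod_(s <- drop n w) s)%g = size (drop n w).
  by apply: geodesic_cat; rewrite cat_take_drop.
exists (\prod_(s <- take n w) s)%g; first by rewrite gx size_takel.
rewrite -{2}(cat_take_drop n w) big_cat /gromov_product /=.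
rewrite (word_distC S _ 1%g) !word_dist1g /word_dist mulKg gx gy.
rewrite size_drop size_takel //.
have -> : word_norm S
    (\prod_(s <- take n w) s * \prod_(s <- drop n w) s)%g = size w.
  by rewrite sw -{3}(cat_take_drop n w) big_cat.
by rewrite natrB //; lra.
Qed.

End GromovProduct.
(** * Extended Gromov products and neighbourhoods at infinity *)

Section Boundary.
Context (R : realType) (G : groupType) (S : finGenSet G).

Local Notation gp := (@gromov_product R G S).
Local Notation boundary := (gromov_boundary R S).
Local Notation compactification := (gromov_compactification R S).
Local Notation infinity := (@AtInfinity R G S).
Local Notation ext := (@extended_gromov_product R G S).

Implicit Types (K : R) (u v a b : nat -> G).

Lemma near_pairP (P : set (nat * nat)) :
  (\forall p \near filter_prod \oo \oo, P p) <->
  exists N, forall i j, (N <= i)%N -> (N <= j)%N -> P (i, j).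
Proof.
split=> [[[A B] /= [[M _ MA] [N _ NB]] ABP]|[N NP]].
  exists (maxn M N) => i j; rewrite !geq_max => /andP[Mi _] /andP[_ Nj].
  by apply: ABP; split; [exact: MA | exact: NB].
exists ([set i | (N <= i)%N], [set j | (N <= j)%N]) => /=.
  by split; exists N.
by move=> [i j] [] /=; exact: NP.
Qed.

(** This replaces the inequality (x | z) >= K between points represented by [u]
    and [v]: it avoids limits inferior and suprema, at the price of depending
    on the representatives up to a multiple of delta. *)
Definition eventually_ge K u v : Prop :=
  exists N, forall i j, (N <= i)%N -> (N <= j)%N -> K <= gp 1%g (u i) (v j).

Lemma equiv_at_infinityP u v :
  equiv_at_infinity R S u v <-> forall K, eventually_ge K u v.
Proof.
rewrite /equiv_at_infinity; split=> [/cvgryPge uv K|uv].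
  exact: (near_pairP _).1 (uv K).
by apply/cvgryPge => K; apply: (near_pairP _).2 (uv K).
Qed.

Lemma eventually_geC K u v : eventually_ge K u v -> eventually_ge K v u.
Proof.
by move=> [N NP]; exists N => i j Ni Nj; rewrite gromov_productC NP.
Qed.

Lemma eventually_geW L K u v :
  K <= L -> eventually_ge L u v -> eventually_ge K u v.
Proof.
by move=> KL [N NP]; exists N => i j Ni Nj; apply: le_trans KL (NP _ _ _ _).
Qed.

Lemma extended_gt K x z : (K%:E < ext x z)%E ->
  exists u v, [/\ represents x u, represents z v & eventually_ge K u v].
Proof.
move=> /ereal_sup_gt[_ [u [v [xu zv ->]]]]; rewrite limf_einfE.
move=> /ereal_sup_gt[_ [V FV <-]] KV; exists u, v; split=> //.
have [N NP] : exists N, forall i j, (N <= i)%N -> (N <= j)%N -> V (i, j).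
  exact/near_pairP.
exists N => i j Ni Nj; rewrite -lee_fin.
apply: le_trans (ltW KV) _; apply: ereal_inf_lbound.
by exists (i, j); first exact: NP.
Qed.

Lemma extended_ge K x z u v :
  represents x u -> represents z v -> eventually_ge K u v ->
  (K%:E <= ext x z)%E.
Proof.
move=> xu zv [N NP].
apply: (@le_trans _ _ (limf_einf
    (fun p : nat * nat => (gp 1%g (u p.1) (v p.2))%:E) (filter_prod \oo \oo))).
  rewrite limf_einfE.
  pose V := [set p : nat * nat | (N <= p.1)%N /\ (N <= p.2)%N].
  have FV : filter_prod \oo \oo V by apply/near_pairP; exists N.
  apply: le_trans (ereal_sup_ubound _); last by exists V.
  by apply: le_ereal_inf_tmp => _ [p [Ni Nj] <-]; rewrite lee_fin NP.
by apply: ereal_sup_ubound; exists u, v.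
Qed.

Section Hyperbolic.
Context (delta : R) (four_point : forall w x y z : G,
  Num.min (gp w x y) (gp w y z) - delta <= gp w x z).

Lemma delta_ge0 : 0 <= delta.
Proof.
have := four_point 1%g 1%g 1%g 1%g.
by rewrite minxx gromov_product_xx word_dist_xx; lra.
Qed.

Lemma gromov_product_trans K w x y z :
  K <= gp w x y -> K <= gp w y z -> K - delta <= gp w x z.
Proof.
move=> xy yz; apply: le_trans (four_point w x y z).
by rewrite lerD2r le_min xy.
Qed.

Lemma eventually_ge_trans K u v a :
  eventually_ge K u v -> eventually_ge K v a -> eventually_ge (K - delta) u a.
Proof.
move=> [M MP] [N NP]; exists (maxn M N) => i j.
rewrite !geq_max => /andP[Mi _] /andP[_ Nj].
apply: (@gromov_product_trans _ _ _ (v (maxn M N))).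
  by rewrite MP // leq_maxl.
by rewrite NP // leq_maxr.
Qed.

Lemma represents_equiv (xi : boundary) u v :
  sval xi u -> sval xi v -> forall K, eventually_ge K u v.
Proof.
have [a _ ->] := svalP xi.
move=> [_ /equiv_at_infinityP au] [_ /equiv_at_infinityP av] K.
have -> : K = K + delta - delta by lra.
by apply: eventually_ge_trans (av _); apply: eventually_geC.
Qed.

(** For a boundary point, the new representative is joined to the old one by
    arbitrarily large Gromov products; for a group element both are eventually
    equal to it, and transitivity would not do since (g | g) is only |g|. *)
Lemma represents_eventually_ge K (z : compactification) u v a :
  represents z v -> represents z a ->
  eventually_ge K u v -> eventually_ge (K - delta) u a.
Proof.
case: z => [g [M _ vg] [N _ ag] [L uv]|xi xv xa uv].
  exists (maxn L (maxn M N)) => i j; rewrite !geq_max.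
  move=> /andP[Li /andP[Mi Ni]] /andP[Lj /andP[Mj Nj]].
  have := uv i j Li Lj; have := delta_ge0.
  by have /= -> := vg j Mj; have /= -> := ag j Nj; lra.
exact: eventually_ge_trans uv (represents_equiv xv xa _).
Qed.

(** The supremum over representatives in the extended product is attained by
    every pair of representatives up to [2 * delta], one [delta] for changing
    each of them. *)
Lemma extended_gt_represents K (x z : compactification) u v :
  (K%:E < ext x z)%E -> represents x u -> represents z v ->
  eventually_ge (K - 2 * delta) u v.
Proof.
move=> /extended_gt[a [b [xa zb ab]]] xu zv.
have -> : K - 2 * delta = K - delta - delta by lra.
apply: (represents_eventually_ge zb zv); apply: eventually_geC.
by apply: (represents_eventually_ge xa xu); apply: eventually_geC.
Qed.

Definition shadow K (xi : boundary) : set compactification :=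
  [set z | (K%:E < ext (infinity xi) z)%E].

Lemma shadow_refl K xi : shadow K xi (infinity xi).
Proof.
have [u cu xiE] := svalP xi.
have xiu : sval xi u by rewrite xiE.
rewrite /shadow /=; apply: (@lt_le_trans _ _ (K + 1)%:E).
  by rewrite lte_fin ltrDl.
by apply: (@extended_ge _ _ _ u u) => //; exact: (represents_equiv xiu xiu).
Qed.

(** One [delta] pays for matching the two representatives of [eta], the other
    for the four-point inequality through [eta]. *)
Lemma shadow_trans K L (xi eta : boundary) z :
  K + 2 * delta < L ->
  shadow L xi (infinity eta) -> shadow L eta z -> shadow K xi z.
Proof.
move=> KL /extended_gt[a [b [xia etab ab]]] /extended_gt[b' [d [etab' zd bd]]].
have ab' := represents_eventually_ge etab etab' ab.
have bd' : eventually_ge (L - delta) b' d.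
  by apply: eventually_geW bd; have := delta_ge0; lra.
rewrite /shadow /=; apply: (@lt_le_trans _ _ (L - delta - delta)%:E).
  by rewrite lte_fin; lra.
exact: extended_ge xia zd (eventually_ge_trans ab' bd').
Qed.

(** The topology is defined by its open sets, so an open set inside the shadow
    has to be exhibited: the points of the shadow having a smaller shadow inside
    it form one, by [shadow_trans]. *)
Lemma nbhs_shadow K xi : nbhs (infinity xi) (shadow K xi).
Proof.
pose U := [set z | shadow K xi z /\
  forall eta, z = infinity eta -> exists L, shadow L eta `<=` shadow K xi].
have oU : open U.
  move=> eta [_ /(_ eta erefl)[L Leta]].
  exists (L + 2 * delta + 1) => z etaz; split.
    by apply: Leta; apply: le_lt_trans etaz; rewrite lee_fin;
      have := delta_ge0; lra.
  move=> zeta zE; exists (L + 2 * delta + 1) => y zetay; apply: Leta.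
  by rewrite zE in etaz; apply: shadow_trans etaz zetay; lra.
rewrite nbhsE; exists U; last by move=> z [].
split=> //; split; first exact: shadow_refl.
by move=> eta [->]; exists K.
Qed.

(** The second property says (1 | u_m)_x <= delta, translated by [x^-1]: all
    geodesics from [1] to a far [u m] pass near [x]. It holds with 0 for the
    [u M] used to choose [x], and carries over to the other [u m] because
    (u_m | u_M)_x is large. *)
Lemma ray_point u (n : nat) : converges_at_infinity R S u ->
  exists x, word_norm S x = n /\
    exists M, forall m, (M <= m)%N -> gp 1%g x^-1%g (x^-1 * u m)%g <= delta.
Proof.
move=> /equiv_at_infinityP /(_ (n%:R + delta + 1))[M MP].
have delta0 := delta_ge0.
have uM : (n <= word_norm S (u M))%N.
  have := MP M M (leqnn M) (leqnn M).
  rewrite gromov_product_xx word_dist1g -(ler_nat R); lra.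
have [x xn x0] := geodesic_point R uM.
exists x; split=> //; exists M => m Mm.
have -> : gp 1%g x^-1%g (x^-1 * u m)%g = gp x 1%g (u m).
  by rewrite -(gromov_productM _ _ x^-1%g x) mulVg mulg1.
rewrite leNgt; apply/negP => lt.
(* A level above delta that both products reach: any excess of (1 | u_m)_x
   over delta would then be inherited by (1 | u_M)_x = 0. *)
have [L [L0 Lx]] : exists L, delta < L /\ L <= gp x 1%g (u m) /\ L <= delta + 1.
  exists (Num.min (gp x 1%g (u m)) (delta + 1)).
  by rewrite lt_min lt ge_min lexx ge_min lexx orbT; split=> //; lra.
have xuu : L <= gp x (u m) (u M).
  have := gromov_product_base R S x 1%g (u m) (u M).
  have := MP m M Mm (leqnn M).
  rewrite word_dist1g xn; lra.
have := gromov_product_trans Lx.1 xuu; rewrite x0; lra.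
Qed.

End Hyperbolic.

(** Compactness at infinity: the geodesic words of the subsequence share the
    prefixes of an infinite word, which plays the role of a limiting ray. *)
Lemma converging_subsequence (g : nat -> G) :
  (forall n, word_norm S (g n) = n) ->
  exists f : nat -> nat, forall i j (n : nat), (n <= i)%N -> (n <= j)%N ->
    n%:R <= gp 1%g (g (f i)) (g (f j)).
Proof.
move=> gn.
have [s sP] := choice (fun n => geodesic_word S (g n)).
have sA n : {subset s n <= S ++ [seq t^-1%g | t <- S]}.
  by have [Ss _ _] := sP n; apply: word_letters.
have s_large n : (n <= size (s n))%N.
  by have [_ -> _] := sP n; rewrite gn.
have [w [f [wn w_mono wf]]] := konig sA s_large.
exists f => i j n ni nj.
have [Si si gi] := sP (f i); have [Sj sj gj] := sP (f j).
rewrite -gi -gj -{1}(wn n).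
apply: gromov_product_prefix; rewrite ?gi ?gj //.
  exact: prefix_trans (w_mono _ _ ni) (wf i).
exact: prefix_trans (w_mono _ _ nj) (wf j).
Qed.

End Boundary.

(** * Equivariant retractions *)

Theorem theorem1p1 (R : realType) (G : groupType) (S : finGenSet G)
    (hyp : gromov_hyperbolic R S) (nonelem : non_elementary G) :
  ~ exists phi : gromov_compactification R S -> gromov_boundary R S,
      retraction phi /\ equivariant phi.
Proof.
move=> [phi [[phi_cont phi_id] phi_eq]].
have [delta four_point] := hyp.
have delta0 := delta_ge0 four_point.
pose xi0 := phi (InGroup R S 1%g).
have [u cu xi0E] := svalP xi0.
have xi0u : sval xi0 u by rewrite xi0E.
have phiE g : sval (phi (InGroup R S g)) (fun n => g * u n)%g.
  have -> : phi (InGroup R S g) = boundary_act g xi0.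
    by rewrite -(phi_eq g (InGroup R S 1%g)) /= mulg1.
  by exists u.
have [x xP] := choice (fun n => ray_point four_point n cu).
have gn n : word_norm S (x n)^-1%g = n by rewrite word_normV (xP n).1.
have [f fP] := converging_subsequence R gn.
pose v n := (x (f n))^-1%g.
have cv : converges_at_infinity R S v.
  apply/equiv_at_infinityP => K.
  exists (Num.truncn K).+1 => i j Ki Kj; apply: le_trans (fP _ _ _ Ki Kj).
  exact/ltW/truncnS_gt.
pose Xi : gromov_boundary R S := exist _ _ (ex_intro2 _ _ v cv erefl).
have Xiv : sval Xi v by [].
(* Of K, two delta are lost in changing representatives and one in the final
   comparison; what is left must exceed the delta of [ray_point]. *)
pose K := 4 * delta + 1.
have : nbhs (AtInfinity Xi) ((@AtInfinity R G S \o phi) @^-1` shadow K Xi).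
  have cont : {for AtInfinity Xi, continuous (@AtInfinity R G S \o phi)}.
    by apply: continuous_comp; [exact: phi_cont | exact: initial_continuous].
  by apply: cont => /=; rewrite phi_id; apply: nbhs_shadow four_point _ _.
rewrite nbhsE => -[B [oB BXi] Bphi].
have [k kB] := oB Xi BXi.
pose n := (Num.truncn (Num.max k K)).+1.
have n_large : Num.max k K < n%:R by apply: truncnS_gt.
have vn i : (n <= i)%N -> n%:R <= gromov_product R S 1%g (v i) (v n).
  by move=> ni; apply: fP.
have /kB/Bphi : (k%:E < extended_gromov_product (AtInfinity Xi) (InGroup R S (v n)))%E.
  apply: (@lt_le_trans _ _ n%:R%:E).
    by rewrite lte_fin; apply: le_lt_trans n_large; rewrite le_max lexx.
  apply: (@extended_ge _ _ _ _ _ _ v (fun=> v n)) => //.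
    by exists 0.
  by exists n => i j ni _; apply: vn.
move=> /(extended_gt_represents four_point)/(_ Xiv (phiE (v n)))[N NP].
have [_ [M MP]] := xP (f n).
have small := MP (maxn M N) (leq_maxl _ _).
(* Compare v n with v n * u m through a far v i. *)
have vvu := NP (maxn n N) (maxn M N) (leq_maxr _ _) (leq_maxr _ _).
have vv : K - 2 * delta <= gromov_product R S 1%g (v n) (v (maxn n N)).
  rewrite gromov_productC; apply: le_trans (vn _ (leq_maxl _ _)).
  by move: n_large; rewrite gt_max => /andP[_]; lra.
have large := gromov_product_trans four_point vv vvu.
by move: (le_trans large small); rewrite /K; lra.
Qed.
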